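(* Fix $p\in[0,1)$. There exists a constant $\beta>0$ depending only on $p$ such that the following holds. Consider a family of planted clique problem instances $\{\Gamma_k,\mathfrak{G}_k\}_{k=1}^\infty$ generated according to the Erdős–Rényi model with probability $p$, where $\Gamma_k$ is the $k$-clique and $\mathfrak{G}_k$ is a graph on $n_k$ nodes. If $n_k\le\beta k^2$, then the Schur–Horn relaxation with $\gamma=-1$ succeeds in identifying $\Gamma_k$ inside $\mathfrak{G}_k$ with probability approaching one exponentially fast in $k$; that is, there are constants $C,c>0$ such that for every $k$ with $n_k\le\beta k^2$ the probability of success is at least $1-Ce^{-ck}$.
   Context: All graphs are undirected, unweighted and loopless. $\mathbb{S}^q$ denotes the real symmetric $q\times q$ matrices, and $A_{\Gamma}\in\mathbb{S}^k$, $A_{\mathfrak{G}}\in\mathbb{S}^n$ denote adjacency matrices of a graph $\Gamma$ on $k$ nodes and a graph $\mathfrak{G}$ on $n>k$ nodes. In a planted subgraph (here: clique) instance, the nodes are labeled so that the leading principal $k\times k$ submatrix of $A_{\mathfrak{G}}$ equals $A_\Gamma$; put $V=\{1,\dots,k\}$. Erdős–Rényi model with probability $p$: for each $i<j$ with $k<j\le n$, $(A_{\mathfrak{G}})_{i,j}=(A_{\mathfrak{G}})_{j,i}$ equals $1$ with probability $p$ and $0$ with probability $1-p$, independently over these pairs. For $M\in\mathbb{S}^k$, $[M]_{k\to n}\in\mathbb{S}^n$ is the matrix with leading principal $k\times k$ submatrix $M$ and all other entries $0$. For $M\in\mathbb{S}^n$, the Schur–Horn orbitope is $\mathcal{SH}(M)=\mathrm{conv}\{UMU'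 : U \text{ an } n\times n \text{ orthogonal matrix}\}$. The Schur–Horn relaxation with parameter $\gamma\in\mathbb{R}$ is $$\max_{A\in\mathbb{S}^n}\ \mathrm{trace}(A A_{\mathfrak{G}})\quad\text{s.t. } A_{i,j}=0 \text{ if } (A_{\mathfrak{G}})_{i,j}=0 \text{ and } i\ne j,\quad A\in\mathcal{SH}([A_\Gamma-\gamma I_k]_{k\to n}).$$ It succeeds at identifying $\Gamma$ if it has a unique optimal solution $\hat A$, $\hat A_{V,V}=\tilde\Pi A_\Gamma\tilde\Pi'-\gamma I_k$ for some $k\times k$ permutation matrix $\tilde\Pi$, and all other entries of $\hat A$ are $0$. *)

(* Defs.v *)
From HB Require Import structures.
From mathcomp Require Import all_boot all_order all_fingroup all_algebra.
From mathcomp Require Import boolp classical_sets reals sequences convex exp.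

Set Implicit Arguments.
Unset Strict Implicit.
Unset Printing Implicit Defensive.

Import Order.TTheory GRing.Theory Num.Theory.

Local Open Scope classical_set_scope.
Local Open Scope ring_scope.

(* Boolean matrices make the simple graphs on n nodes a finType, so that a
   probability on them is a finite sum. *)
Record sgraph (n : nat) := SGraph {
  edge :> 'M[bool]_n;
  edge_simple : (edge^T == edge) && [forall i, ~~ edge i i] }.

HB.instance Definition _ n := [isSub for @edge n].
HB.instance Definition _ n := [Equality of sgraph n by <:].
HB.instance Definition _ n := [Choice of sgraph n by <:].
HB.instance Definition _ n := [Countable of sgraph n by <:].
HB.instance Definition _ n := [Finite of sgraph n by <:].

Definition adjmx (R : pzSemiRingType) (n : nat) (G : sgraph n) : 'M[R]_n :=
  \matrix_(i, j) (G i j)%:R.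

Definition clique_mx (k : nat) : 'M[bool]_k := \matrix_(i, j) (i != j).

Lemma clique_simple (k : nat) :
  ((clique_mx k)^T == clique_mx k) && [forall i, ~~ clique_mx k i i].
Proof.
apply/andP; split; last by apply/forallP => i; rewrite mxE eqxx.
by apply/eqP/matrixP => i j; rewrite !mxE eq_sym.
Qed.

Definition clique (k : nat) : sgraph k := SGraph (clique_simple k).

Section SchurHorn.
Variable R : realType.

Definition orthogonal_mx (n : nat) : set 'M[R]_n :=
  [set U | U *m U^T = 1%:M].

Definition schur_horn_orbitope (n : nat) (M : 'M[R]_n) : set 'M[R]_n :=
  smallest (@convex_set R 'M[R]_n)
    [set U *m M *m U^T | U in @orthogonal_mx n].

(* The host graph has n = k + m nodes, the first k of which carry the planted
   subgraph. *)
Variables k m : nat.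

Definition pad (M : 'M[R]_k) : 'M[R]_(k + m) := block_mx M 0 0 0.

Variables (Gamma : sgraph k) (gamma : R) (G : sgraph (k + m)).

Definition sh_feasible : set 'M[R]_(k + m) :=
  [set A | [/\ A^T = A,
               forall i j, adjmx R G i j = 0 -> i != j -> A i j = 0
             & schur_horn_orbitope (pad (adjmx R Gamma - gamma%:M)) A]].

Definition sh_optimal : set 'M[R]_(k + m) :=
  [set A | sh_feasible A /\
           forall B, sh_feasible B ->
             \tr (B *m adjmx R G) <= \tr (A *m adjmx R G)].

Definition sh_succeeds : Prop :=
  exists A : 'M[R]_(k + m),
    [/\ sh_optimal A,
        forall B, sh_optimal B -> B = A
      & exists s : 'S_k,
          A = pad (perm_mx s *m adjmx R Gamma *m (perm_mx s)^T - gamma%:M)].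

End SchurHorn.

Definition planted (k m : nat) (Gamma : sgraph k) (G : sgraph (k + m)) : bool :=
  ulsubmx G == Gamma :> 'M[bool]_k.

(* Probability mass of G: the pairs i < j of nodes not both in the planted part
   (nodes are numbered from 0, so these are the pairs with k <= j) are
   independent Bernoulli(p). *)
Definition er_mass (R : realType) (p : R) (k m : nat) (Gamma : sgraph k)
    (G : sgraph (k + m)) : R :=
  if planted Gamma G then
    \prod_(ij : 'I_(k + m) * 'I_(k + m) | (ij.1 < ij.2)%N && (k <= ij.2)%N)
      (if G ij.1 ij.2 then p else 1 - p)
  else 0.

Definition er_prob (R : realType) (p : R) (k m : nat) (Gamma : sgraph k)
    (E : set (sgraph (k + m))) : R :=
  \sum_(G | G \in E) er_mass p Gamma G.

(* Main.v *)
Require Import Defs.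
From mathcomp Require Import all_boot all_order all_fingroup all_algebra.
From mathcomp Require Import boolp classical_sets reals sequences convex exp.
From mathcomp Require Import interval_inference zify ring lra.

Set Implicit Arguments.
Unset Strict Implicit.
Unset Printing Implicit Defensive.

Import Order.TTheory GRing.Theory Num.Theory.

Local Open Scope classical_set_scope.
Local Open Scope ring_scope.

(** For the clique and gamma = -1 the padded matrix is E = v v^T, where v is the
    indicator of the planted nodes, so its Schur-Horn orbitope is the convex hull
    of the matrices u u^T with |u|^2 = k, and the relaxation is a Lovasz theta
    problem.  Write (A, B) for tr (A B^T).

    Certificate.  A feasible A vanishes on non-edges, so the objective at A is
    (M, A) - tr A for every symmetric M whose entries are 1 on the diagonal and
    on the edges, whatever its entries on the non-edges.  If moreover
      2 z^T M z <= k |z|^2 + z^T E z   for all z,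
    then the same inequality holds between the pairings of M, of the identity
    and of E with any point A of the orbitope, and
    |A - E|^2 <= 2 (k^2 - (E, A)) because the orbitope lies in the ball of
    radius k of the Frobenius norm.  Hence the objective is at most k^2 - k, and
    equality forces A = E ([dual_certificate]).

    Construction of M.  Let W be the centred adjacency matrix: entries a_ij - p
    off the diagonal and outside the planted block, zero elsewhere.  The free
    entries of M are chosen so that M v = k v and so that, up to bounded column
    scalings and an identity block, M acts as W on the complement of v.  This
    works as soon as k >= 8, W has operator norm at most (1 - p) k / 16 and no
    outside node has more than k (1 + p) / 2 neighbours in the clique
    ([planted_succeeds]).

    Probability.  Both requirements bound bilinear forms z^T W w, and each form
    has a subgaussian tail ([noise_tail]), from exp x <= x + exp (2 x^2).  The
    degrees need at most n forms, each failing with probability exp (- c k).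
    For the norm, a unit vector scaled by sqrt n can be rounded, coordinate by
    coordinate and without decreasing a given linear form, to an integer vector
    of squared length at most 4 n; there are at most exp (6 n) of these
    ([card_lattice_short]), and each pair fails with probability exp (- c k^2).
    The union bound over exp (12 n) pairs is harmless when n <= beta k^2 with
    beta small. *)

(** * Graphs *)

Lemma edge_sym n (G : sgraph n) i j : G i j = G j i.
Proof.
by have /andP[/eqP/matrixP/(_ j i) GT _] := edge_simple G; rewrite -GT mxE.
Qed.

Lemma edge_irr n (G : sgraph n) i : G i i = false.
Proof. by have /andP[_ /forallP/(_ i)/negbTE] := edge_simple G. Qed.

Lemma planted_edge k m (G : sgraph (k + m)) (i j : 'I_(k + m)) :
  planted (clique k) G -> (i < k)%N -> (j < k)%N -> G i j = (i != j).
Proof.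
case: (split_ordP i) => i' ->; case: (split_ordP j) => j' -> /eqP /matrixP;
  rewrite /= ?(ltnNge (k + _)) ?leq_addr // => /(_ i' j'); rewrite !mxE => -> _ _.
by rewrite (inj_eq (@lshift_inj _ _)).
Qed.

(** * The orbitope of the planted clique and its dual certificate *)

Lemma orbitope_ind (R : realType) (n : nat) (M : 'M[R]_n) (Q : 'M[R]_n -> Prop) :
    (forall U, orthogonal_mx U -> Q (U *m M *m U^T)) ->
    (forall (t : R) A B, 0 <= t -> t <= 1 -> Q A -> Q B ->
       Q (t *: A + (1 - t) *: B)) ->
  forall A, schur_horn_orbitope M A -> Q A.
Proof.
move=> Qorb Qcvx; apply: smallest_sub => [A B t|_ [U oU <-]]; last exact: Qorb.
rewrite !inE => QA QB.
apply: (Qcvx t%:num) => //.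
Qed.

Definition planted_ones (R : realType) (k m : nat) : 'M[R]_(k + m) := pad m (const_mx 1).

Lemma mxtrace_mul_sum (R : realType) (a b : nat) (A : 'M[R]_(a,b)) (B : 'M[R]_(b,a)) :
  \tr (A *m B) = \sum_i \sum_j A i j * B j i.
Proof. by apply: eq_bigr => i _; rewrite mxE. Qed.

Lemma pad_clique (R : realType) (k m : nat) :
  pad m (adjmx R (clique k) - (-1)%:M) = planted_ones R k m.
Proof.
congr pad; apply/matrixP => i j; rewrite !mxE.
by case: eqP => _ /=; rewrite ?mulrN1z ?mulr0n ?mulr1n ?subr0 ?opprK ?add0r ?oppr0 ?addr0.
Qed.

Definition planted_vec (R : realType) k m : 'cV[R]_(k + m) := col_mx (const_mx 1) 0.

Lemma planted_ones_rank1 (R : realType) k m :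
  planted_ones R k m = planted_vec R k m *m (planted_vec R k m)^T.
Proof.
rewrite tr_col_mx mul_col_row !trmx0 !mulmx0 !mul0mx; congr block_mx.
by apply/matrixP => i j; rewrite !mxE big_ord1 !mxE mulr1.
Qed.

Lemma mxtrace_planted_ones (R : realType) k m : \tr (planted_ones R k m) = k%:R.
Proof.
rewrite /planted_ones /pad mxtrace_block mxtrace0 addr0 /mxtrace.
by rewrite (eq_bigr (fun=> 1)) ?sumr_const ?card_ord // => i; rewrite mxE.
Qed.

(** The orbit of v v^T under the orthogonal group consists of matrices u u^T with
    |u| = |v|; statements that survive convex combinations need only be proved
    there, so no spectral theorem is involved. *)
Lemma orbitope_rank1_ind (R : realType) (k m : nat) (Q : 'M[R]_(k + m) -> Prop) :
    (forall v : 'cV_(k + m), \tr (v *m v^T) = k%:R -> Q (v *m v^T)) ->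
    (forall (t : R) A B, 0 <= t -> t <= 1 -> Q A -> Q B ->
       Q (t *: A + (1 - t) *: B)) ->
  forall A, schur_horn_orbitope (planted_ones R k m) A -> Q A.
Proof.
move=> Qv; apply: orbitope_ind => U oU.
have -> : U *m planted_ones R k m *m U^T =
    (U *m planted_vec R k m) *m (U *m planted_vec R k m)^T.
  by rewrite trmx_mul planted_ones_rank1 !mulmxA.
apply: Qv; rewrite trmx_mul mxtrace_mulC -mulmxA [U^T *m _]mulmxA.
by rewrite (mulmx1C oU) mul1mx mxtrace_mulC -planted_ones_rank1 mxtrace_planted_ones.
Qed.

Lemma planted_onesE (R : realType) k m (i j : 'I_(k + m)) :
  planted_ones R k m i j = ((i < k) && (j < k))%N%:R.
Proof.
case: (split_ordP i) => i' ->; case: (split_ordP j) => j' ->;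
  rewrite /planted_ones /pad ?block_mxEul ?block_mxEur ?block_mxEdl ?block_mxEdr !mxE /=;
  by rewrite ?ltn_ord ?(ltnNge (k + _)) ?leq_addr ?andbF.
Qed.

(** A feasible matrix is supported on edges and diagonal, where M is 1, so M
    replaces the adjacency matrix in the objective.  Bounding 2 M by k I + E,
    rather than M by k I, leaves a margin of half the spectral gap: at an optimum
    it forces the pairing with E up to k^2, and then the Frobenius distance to
    E is 0.  Uniqueness thus follows without a study of complementary slackness. *)
Lemma dual_certificate (R : realType) (k m : nat) (G : sgraph (k + m))
    (M : 'M[R]_(k + m)) :
    planted (clique k) G ->
    (forall i j, G i j || (i == j) -> M i j = 1) ->
    (forall z : 'cV_(k + m),
       2 * \tr (M *m (z *m z^T)) <=
         k%:R * \tr (z *m z^T) + \tr (planted_ones R k m *m (z *m z^T))) ->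
  sh_succeeds (clique k) (-1 : R) G.
Proof.
move=> plG Mone Mle.
set E := planted_ones R k m.
have trE : \tr E = k%:R by exact: mxtrace_planted_ones.
have ET : E^T = E by rewrite /E planted_ones_rank1 trmx_mul trmxK.
have sqE : \tr (E *m E^T) = k%:R ^+ 2.
  rewrite ET; transitivity (\tr (k%:R *: E)); last by rewrite mxtraceZ trE.
  congr mxtrace; rewrite /E /planted_ones /pad mulmx_block !mulmx0 !mul0mx !addr0.
  rewrite scale_block_mx !scaler0; congr block_mx.
  apply/matrixP => i j; rewrite !mxE (eq_bigr (fun=> 1)) => [|l _]; last by rewrite !mxE mulr1.
  by rewrite sumr_const card_ord mulr1.
have orbE : schur_horn_orbitope E E.
  move=> A [_ orbA]; apply: orbA; exists 1%:M; first by rewrite /orthogonal_mx /= trmx1 mulmx1.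
  by rewrite trmx1 mulmx1 mul1mx.
have orbP (B : 'M[R]_(k + m)) : schur_horn_orbitope E B ->
  [/\ \tr B = k%:R, \tr (B *m B^T) <= k%:R ^+ 2 &
      2 * \tr (M *m B) <= k%:R * \tr B + \tr (E *m B)].
  move: B; apply: (@orbitope_rank1_ind R k m (fun B => [/\ _, _ & _])) =>
    [v tv|t A C t0 t1 [tA nA cA] [tC nC cC]].
    split=> //; rewrite trmx_mul trmxK mulmxA.
    have vv : v^T *m v = (k%:R)%:M.
      by rewrite [LHS]mx11_scalar -trace_mx11 mxtrace_mulC tv.
    by rewrite -[v *m v^T *m v]mulmxA vv mul_mx_scalar -scalemxAl mxtraceZ tv.
  rewrite !mulmxDr -!scalemxAr !mxtraceD !mxtraceZ; split.
  - by rewrite tA tC -mulrDl addrC subrK mul1r.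
  - have -> : k%:R ^+ 2 = t * k%:R ^+ 2 + (1 - t) * k%:R ^+ 2 :> R by ring.
    apply: (@le_trans _ _ (t * \tr (A *m A^T) + (1 - t) * \tr (C *m C^T))); last first.
      by apply: lerD; apply: ler_wpM2l => //; rewrite subr_ge0.
    rewrite !mxtrace_mul_sum !mulr_sumr -big_split /=; apply: ler_sum => i _.
    rewrite !mulr_sumr -big_split /=; apply: ler_sum => j _; rewrite !mxE.
    move: (A i j) (C i j) => a c; rewrite -subr_ge0.
    have -> : t * (a * a) + (1 - t) * (c * c) -
       (t * a + (1 - t) * c) * (t * a + (1 - t) * c) = t * (1 - t) * (a - c) ^+ 2.
      by ring.
    by apply: mulr_ge0 (sqr_ge0 _); apply: mulr_ge0 => //; rewrite subr_ge0.
  - have := ler_wpM2l t0 cA; have := @ler_wpM2l _ (1 - t) _ _ _ cC.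
    rewrite subr_ge0 => /(_ t1); rewrite tA tC; lra.
have dist (B : 'M[R]_(k + m)) : schur_horn_orbitope E B ->
  \sum_i \sum_j (B i j - E i j) ^+ 2 <= 2 * k%:R ^+ 2 - 2 * \tr (E *m B).
  move=> /orbP[_ nB _].
  suff -> : \sum_i \sum_j (B i j - E i j) ^+ 2 =
    \tr (B *m B^T) + \tr (E *m E^T) - 2 * \tr (E *m B) by rewrite sqE; lra.
  rewrite [\tr (E *m B)]mxtrace_mulC -[in \tr (B *m E)]ET !mxtrace_mul_sum.
  rewrite mulr_sumr -big_split -sumrB /=; apply: eq_bigr => i _.
  rewrite mulr_sumr -big_split -sumrB /=; apply: eq_bigr => j _.
  by rewrite !mxE; ring.
have EB (B : 'M[R]_(k + m)) : schur_horn_orbitope E B -> \tr (E *m B) <= k%:R ^+ 2.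
  move=> /dist; set s := \sum_i _ => sB.
  have : 0 <= s by rewrite !sumr_ge0 // => i _; rewrite sumr_ge0 // => j _; rewrite sqr_ge0.
  lra.
have obj (B : 'M[R]_(k + m)) : sh_feasible (clique k) (-1 : R) G B ->
  \tr (B *m adjmx R G) = \tr (M *m B) - \tr B.
  move=> [sB zB _]; rewrite mxtrace_mulC.
  transitivity (\sum_i \sum_j (M i j * B j i - (if i == j then B j i else 0))); last first.
    rewrite mxtrace_mul_sum /mxtrace -sumrB; apply: eq_bigr => i _.
    by rewrite sumrB -big_mkcond (big_pred1 i) // => j; rewrite eq_sym.
  rewrite mxtrace_mul_sum; apply: eq_bigr => i _; apply: eq_bigr => j _; rewrite mxE.
  have [<-|ne] := eqVneq i j; first by rewrite edge_irr Mone ?eqxx ?orbT// mul0r mul1r subrr.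
  case Gij : (G i j); first by rewrite Mone ?Gij// subr0.
  by rewrite -sB mxE zB ?mulr0 ?subr0 ?mxE ?Gij.
have feasE : sh_feasible (clique k) (-1 : R) G E.
  split=> //; last by rewrite pad_clique.
  move=> i j; rewrite mxE planted_onesE; case: andP => // -[ik jk].
  by rewrite (planted_edge plG) //; case: eqP => //= _ /eqP; rewrite oner_eq0.
have feas_orb (B : 'M[R]_(k + m)) : sh_feasible (clique k) (-1 : R) G B -> schur_horn_orbitope E B.
  by move=> [_ _]; rewrite pad_clique.
have objE : \tr (E *m adjmx R G) = k%:R ^+ 2 - k%:R.
  rewrite obj // trE; congr (_ - _); rewrite -sqE ET !mxtrace_mul_sum.
  apply: eq_bigr => i _; apply: eq_bigr => j _.
  rewrite !planted_onesE andbC; case: andP => [[ik jk]|]; last by rewrite !mulr0.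
  by rewrite Mone // (planted_edge plG) // orNb.
exists E; split.
- split=> // B fB; rewrite objE obj //.
  have [tB _ cB] := orbP _ (feas_orb _ fB); have := EB _ (feas_orb _ fB).
  rewrite tB in cB *; nra.
- move=> B [fB /(_ _ feasE)]; rewrite objE obj // => oB.
  have [tB _ cB] := orbP _ (feas_orb _ fB); have dB := dist _ (feas_orb _ fB).
  have s0 : \sum_i \sum_j (B i j - E i j) ^+ 2 <= 0 by rewrite tB in cB oB; nra.
  apply/matrixP => i j; apply/eqP; rewrite -subr_eq0 -sqrf_eq0 eq_le sqr_ge0 andbT.
  apply: le_trans s0; rewrite (bigD1 i) //= (bigD1 j) //= -addrA lerDl.
  by rewrite addr_ge0 // !sumr_ge0 // => l _; rewrite ?sqr_ge0 // sumr_ge0 // => l' _; rewrite sqr_ge0.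
- exists 1%g; rewrite perm_mx1 trmx1 mulmx1 mul1mx pad_clique //.
Qed.

(** * The certificate of a random graph *)

(** The planted block and the diagonal are deterministic, hence centred to 0. *)
Definition noise (R : realType) (p : R) k m (G : sgraph (k + m)) : 'M[R]_(k + m) :=
  \matrix_(i, j)
    if (i != j) && ~~ ((i < k) && (j < k))%N then (G i j)%:R - p else 0.

Lemma sum_planted_nodes (R : realType) k m :
  \sum_(i < k + m) (i < k)%N%:R = k%:R :> R.
Proof.
rewrite big_split_ord /= (eq_bigr (fun=> 1)) => [|i _]; last by rewrite ltn_ord.
rewrite sumr_const card_ord big1 ?addr0 // => i _.
by rewrite ltnNge leq_addr.
Qed.

(** With d_j the number of clique neighbours of an outside node j, the equation
    M v = k v forces the average of the non-edge entries of column j to be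
    - d_j / (k - d_j).  Taking them all equal makes the column proportional to
    the centred column (a_ij - d_j / k)_i, which is the projection of the
    j-th column of W orthogonally to the all-ones vector.  Between outside nodes
    the non-edge entry - p / (1 - p) makes M equal to I + W / (1 - p).  In z^T M z
    only the part x of z that is orthogonal to v then meets the off-diagonal
    blocks, so the norm bound on W is enough. *)
Lemma planted_succeeds (R : realType) (p : R) (k m : nat) (G : sgraph (k + m)) :
    p < 1 -> (8 <= k)%N -> planted (clique k) G ->
    (forall j : 'I_(k + m), (k <= j)%N ->
       \sum_(i < k + m | (i < k)%N) noise p G i j <= (1 - p) / 2 * k%:R) ->
    (forall z w : 'I_(k + m) -> R,
       2 * (\sum_i \sum_j z i * noise p G i j * w j) <=
       (1 - p) / 16 * k%:R * (\sum_i z i ^+ 2 + \sum_i w i ^+ 2)) ->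
  sh_succeeds (clique k) (-1 : R) G.
Proof.
move=> p1 k8 plG degP noiseP.
have q0 : 0 < 1 - p by rewrite subr_gt0.
have k0 : 0 < k%:R :> R by rewrite ltr0n; apply: leq_trans k8.
pose W := noise p G.
pose v (i : 'I_(k + m)) : R := (i < k)%N%:R.
pose u (i : 'I_(k + m)) : R := 1 - v i.
(* The number d_j of clique neighbours of j satisfies d_j / k = p + mu j, so t j
   is k / (k - d_j). *)
pose mu j := k%:R^-1 * \sum_i v i * W i j.
pose t j := (1 - p - mu j)^-1.
have vv i : v i * v i = v i by rewrite /v; case: (_ < _)%N; rewrite ?mulr1 ?mulr0.
have uu i : u i * u i = u i by rewrite /u /v; case: (_ < _)%N => /=; ring.
have t_bounds (j : 'I_(k + m)) : (k <= j)%N -> 0 < 1 - p - mu j /\ 0 <= (1 - p) / 2 * t j <= 1.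
  move=> kj; have := degP _ kj; rewrite big_mkcond /= => dj.
  have : mu j <= (1 - p) / 2.
    rewrite /mu ler_pdivrMl // mulrC; apply: le_trans dj; rewrite le_eqVlt; apply/orP; left; apply/eqP.
    by apply: eq_bigr => i _; rewrite /v; case: (_ < _)%N; rewrite ?mul1r ?mul0r.
  rewrite /t => muj; have tp : 0 < 1 - p - mu j by lra.
  split=> //; apply/andP; split; last by rewrite ler_pdivrMr //; lra.
  by rewrite mulr_ge0 ?invr_ge0 //; lra.
pose M : 'M[R]_(k + m) := \matrix_(i, j)
  (v i * v j + v i * u j * (t j * (W i j - mu j))
   + v j * u i * (t i * (W j i - mu i))
   + u i * u j * ((i == j)%:R + (1 - p)^-1 * W i j)).
have cross (i j : 'I_(k + m)) : (i < k)%N -> (k <= j)%N -> G i j -> t j * (W i j - mu j) = 1.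
  move=> ik kj Gij; have [tp _] := t_bounds _ kj.
  rewrite /W mxE (ltnNge j) kj andbF andbT ifT; last first.
    by rewrite neq_ltn (leq_trans ik kj).
  by rewrite Gij mulVf // gt_eqF.
apply: (@dual_certificate _ _ _ _ M) => //.
  move=> i j Gij; rewrite mxE /u /v.
  case: (ltnP i k) => ik; case: (ltnP j k) => jk /=.
  - by rewrite subrr; ring.
  - rewrite subr0 cross //; first by ring.
    by case/orP: Gij => // /eqP ij; rewrite ij ltnNge jk in ik.
  - rewrite subr0 (cross j i) //; first by ring.
    by rewrite edge_sym; case/orP: Gij => // /eqP ij; rewrite ij leqNgt jk in ik.
  - rewrite mxE ltnNge ik /= andbT; case: eqP Gij => [ij _|_] /=; first by ring.
    rewrite orbF => -> /=; field; exact: lt0r_neq0.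
move=> z.
pose Z i := z i 0.
(* z = (s / k) v + x + y, with x on the clique and orthogonal to v, and y outside;
   w is y with its coordinates shrunk by the factors of t_bounds. *)
pose s := \sum_i v i * Z i.
pose x i := v i * (Z i - s / k%:R).
pose y i := u i * Z i.
pose w i := (1 - p) / 2 * t i * y i.
have sumv : \sum_i v i = k%:R by exact: sum_planted_nodes.
have trz : \tr (z *m z^T) = \sum_i x i ^+ 2 + s ^+ 2 / k%:R + \sum_i y i ^+ 2.
  have -> : \sum_i x i ^+ 2 = \sum_i v i * Z i ^+ 2 - s ^+ 2 / k%:R.
    transitivity (\sum_i (v i * Z i ^+ 2 - 2 * s / k%:R * (v i * Z i)
                          + s ^+ 2 / k%:R ^+ 2 * v i)).
      by apply: eq_bigr => i _; rewrite /x exprMn [v i ^+ 2]vv; field; exact: lt0r_neq0.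
    rewrite big_split /= sumrB -!mulr_sumr sumv -/s; field; exact: lt0r_neq0.
  rewrite subrK -big_split /=; apply: eq_bigr => i _.
  rewrite mxE big_ord1 mxE /y exprMn [u i ^+ 2]uu -/(Z i) /u; ring.
have trEz : \tr (planted_ones R k m *m (z *m z^T)) = s ^+ 2.
  rewrite mxtrace_mul_sum expr2 mulr_suml; apply: eq_bigr => i _.
  rewrite mulr_sumr; apply: eq_bigr => j _.
  by rewrite planted_onesE !mxE big_ord1 !mxE /Z /v; case: (_ < _)%N; case: (_ < _)%N => /=; ring.
pose T := \sum_i \sum_j x i * W i j * (t j * y j).
pose Y := \sum_i \sum_j y i * W i j * y j.
(* Centring column j of W is the same as projecting z orthogonally to v. *)
have colE j : \sum_i v i * Z i * (W i j - mu j) = \sum_i x i * W i j.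
  transitivity (\sum_i v i * Z i * W i j - s * mu j).
    rewrite /s mulr_suml -sumrB; apply: eq_bigr => i _; ring.
  transitivity (\sum_i v i * Z i * W i j - s / k%:R * \sum_i v i * W i j).
    by rewrite /mu; ring.
  rewrite mulr_sumr -sumrB; apply: eq_bigr => i _; rewrite /x; ring.
have TE : \sum_i \sum_j v i * u j * (t j * (W i j - mu j)) * (Z i * Z j) = T.
  rewrite /T exchange_big [RHS]exchange_big /=; apply: eq_bigr => j _.
  rewrite -mulr_suml -colE mulr_suml; apply: eq_bigr => i _; rewrite /y; ring.
have trM : \tr (M *m (z *m z^T)) = s ^+ 2 + 2 * T + \sum_i y i ^+ 2 + (1 - p)^-1 * Y.
  have -> : 2 * T = T + T by ring.
  rewrite -{1}TE -[in X in _ + (_ + X)]TE [X in _ + (_ + X)]exchange_big /=.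
  have -> : s ^+ 2 = \sum_i \sum_j v i * v j * (Z i * Z j).
    rewrite expr2 mulr_suml; apply: eq_bigr => i _.
    rewrite mulr_sumr; apply: eq_bigr => j _; ring.
  have -> : \sum_i y i ^+ 2 = \sum_i \sum_j (i == j)%:R * (y i * y j).
    apply: eq_bigr => i _; rewrite (bigD1 i) //= big1 ?eqxx ?addr0 ?mul1r // => j.
    by rewrite eq_sym => /negbTE ->; rewrite mul0r.
  rewrite mxtrace_mul_sum /Y mulr_sumr -!big_split /=; apply: eq_bigr => i _.
  rewrite mulr_sumr -!big_split /=; apply: eq_bigr => j _.
  rewrite !mxE big_ord1 !mxE -/(Z i) -/(Z j) /y; ring.
have w_le : \sum_i w i ^+ 2 <= \sum_i y i ^+ 2.
  apply: ler_sum => i _; rewrite /w /y /u /v; case: ltnP => ki /=.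
    by rewrite subrr !mul0r mulr0.
  rewrite [_ ^+ 2]exprMn ler_piMl ?sqr_ge0 //.
  by have [_ /andP[t0 t1]] := t_bounds _ ki; rewrite expr_le1.
have Tle : (1 - p) / 2 * T = \sum_i \sum_j x i * W i j * w j.
  rewrite mulr_sumr; apply: eq_bigr => i _; rewrite mulr_sumr; apply: eq_bigr => j _.
  rewrite /w; ring.
have := noiseP x w; rewrite -/W -Tle => T1.
have := noiseP y y; rewrite -/W -/Y => Y1.
rewrite trz trEz trM.
have k8' : 8 <= k%:R :> R by rewrite ler_nat.
set X2 := \sum_i x i ^+ 2 in T1 *; set Y2 := \sum_i y i ^+ 2 in T1 Y1 w_le *.
have X0 : 0 <= X2 by rewrite sumr_ge0 // => i _; rewrite sqr_ge0.
have Y0 : 0 <= Y2 by rewrite sumr_ge0 // => i _; rewrite sqr_ge0.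
have T2 : 16 * T <= k%:R * (X2 + Y2).
  rewrite -(ler_pM2l q0).
  have : (1 - p) * (k%:R * (X2 + \sum_i w i ^+ 2)) <= (1 - p) * (k%:R * (X2 + Y2)).
    by rewrite !ler_pM2l // lerD2l.
  move: T1; lra.
have Y3 : 16 * ((1 - p)^-1 * Y) <= k%:R * Y2.
  rewrite -(ler_pM2l q0).
  have -> : (1 - p) * (16 * ((1 - p)^-1 * Y)) = 16 * Y by field; exact: lt0r_neq0.
  move: Y1; lra.
have Y4 : 8 * Y2 <= k%:R * Y2 by rewrite ler_wpM2r.
have X4 : 0 <= k%:R * X2 by rewrite mulr_ge0 // ltW.
have -> : k%:R * (X2 + s ^+ 2 / k%:R + Y2) = k%:R * X2 + s ^+ 2 + k%:R * Y2.
  by field; exact: lt0r_neq0.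
lra.
Qed.

(** * Exponential moments in the random graph model *)

(** Taking expectations at a centred x kills the linear term, which gives a
    subgaussian bound.  For x < 1/2 it follows from
    exp x <= (1 - x / 2)^-2 <= 1 + x + 2 x^2; beyond that x <= 2 x^2. *)
Lemma expR_le_lin_sqr (R : realType) (x : R) : expR x <= x + expR (2 * x ^+ 2).
Proof.
have [x1|x1] := ltP x (1 / 2); last first.
  apply: (@le_trans _ _ (expR (2 * x ^+ 2))); last by rewrite lerDr; lra.
  rewrite ler_expR; nra.
apply: (@le_trans _ _ (1 + x + 2 * x ^+ 2)); last first.
  by have := expR_ge1Dx (2 * x ^+ 2); lra.
have h : 0 < 1 - x / 2 by lra.
have e : expR x = (expR (- (x / 2)) ^+ 2)^-1.
  by rewrite -expRM_natr -expRN; congr expR; lra.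
have l : 1 - x / 2 <= expR (- (x / 2)) by have := expR_ge1Dx (- (x / 2)).
rewrite e -[leLHS]mul1r ler_pdivrMr ?exprn_gt0 ?expR_gt0 //.
have : (1 - x / 2) ^+ 2 <= expR (- (x / 2)) ^+ 2.
  by rewrite ler_pXn2r // nnegrE ?expR_ge0 // ltW.
have P : 0 <= 1 + x + 2 * x ^+ 2 by nra.
move=> /(ler_wpM2l P); apply: le_trans.
have -> : (1 + x + 2 * x ^+ 2) * (1 - x / 2) ^+ 2 =
   1 + x ^+ 2 * (5 / 4 - 7 / 4 * x + x ^+ 2 / 2) by field.
rewrite lerDl mulr_ge0 ?sqr_ge0 //; nra.
Qed.

(** The index set of the random entries, as in [er_mass]. *)
Definition free_pair k m : pred ('I_(k + m) * 'I_(k + m)) :=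
  fun ij => (ij.1 < ij.2)%N && (k <= ij.2)%N.

(** The planted graph whose free entries are read off f; every planted graph
    arises this way from exactly one f supported on the free pairs. *)
Definition clique_plus k m (f : {ffun 'I_(k + m) * 'I_(k + m) -> bool}) :
  'M[bool]_(k + m) :=
  \matrix_(i, j)
    if ((i < k) && (j < k))%N then i != j
    else if (i < j)%N then f (i, j) else if (j < i)%N then f (j, i) else false.

Lemma clique_plus_simple k m f :
  ((clique_plus f)^T == clique_plus f :> 'M_(k + m)) &&
  [forall i, ~~ clique_plus f i i].
Proof.
apply/andP; split; last first.
  by apply/forallP => i; rewrite mxE eqxx ltnn; case: ifP.
apply/eqP/matrixP => i j; rewrite !mxE andbC eq_sym.
by case: ifP => // _; case: ltngtP.
Qed.

(** Independence of the free entries: expectations of products factor. *)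
Lemma sum_planted_prod (R : realType) k m
    (F : 'I_(k + m) * 'I_(k + m) -> bool -> R) :
  \sum_(G : sgraph (k + m) | planted (clique k) G)
     \prod_(ij | @free_pair k m ij) F ij (G ij.1 ij.2) =
  \prod_(ij | @free_pair k m ij) (F ij true + F ij false).
Proof.
pose h (f : {ffun 'I_(k + m) * 'I_(k + m) -> bool}) := SGraph (clique_plus_simple f).
pose g (G : sgraph (k + m)) := [ffun ij => @free_pair k m ij && G ij.1 ij.2].
rewrite [RHS](eq_bigr (fun ij => \sum_b F ij b)) => [|ij _]; last first.
  by rewrite big_bool.
rewrite (big_distr_big false) /=.
have hE f ij : free_pair ij -> h f ij.1 ij.2 = f ij.
  case: ij => i j /andP[/= ij kj].
  by rewrite mxE ij [(j < k)%N]ltnNge kj andbF.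
rewrite (reindex_onto h g) /=; last first.
  move=> G plG; apply/val_inj/matrixP => i j /=; rewrite mxE !ffunE /free_pair /=.
  have [ik|ik] := ltnP i k; have [jk|jk] := ltnP j k => /=.
  - by rewrite (planted_edge plG).
  - by rewrite (leq_trans ik jk).
  - by rewrite ltnNge (leq_trans (ltnW jk) ik) /= (leq_trans jk ik) ?andbT edge_sym.
  - rewrite !andbT; have [|//|] := ltngtP i j => //.
    + by rewrite edge_sym.
    + by move/val_inj ->; rewrite edge_irr.
apply: eq_big => [f|f _]; last by apply: eq_bigr => ij /hE ->.
apply/andP/pffun_onP => [[_ /eqP gf]|[supp _]].
  split=> //; apply/fintype.subsetP => ij; rewrite inE -{1}gf ffunE unfold_in.
  by rewrite /free_pair; case: ((ij.1 < ij.2)%N && (k <= ij.2)%N); rewrite ?eqxx.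
split.
  apply/eqP/matrixP => i j; rewrite !mxE /= !ltn_ord /=.
  by rewrite (inj_eq (@lshift_inj _ _)).
apply/eqP/ffunP => ij; rewrite ffunE.
case: (boolP (free_pair ij)) => [fr|nf] /=; first by rewrite hE.
by apply/esym/negbTE; apply: contra nf => fij; apply: (fintype.subsetP supp); rewrite inE fij.
Qed.

Lemma er_mass_ge0 (R : realType) (p : R) k m (Gamma : sgraph k) (G : sgraph (k + m)) :
  0 <= p <= 1 -> 0 <= er_mass p Gamma G.
Proof.
move=> /andP[p0 p1]; rewrite /er_mass; case: ifP => // _.
by apply: prodr_ge0 => ij _; case: ifP => // _; rewrite subr_ge0.
Qed.

Lemma er_mass_sum1 (R : realType) (p : R) k m :
  \sum_(G : sgraph (k + m)) er_mass p (clique k) G = 1.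
Proof.
rewrite -big_mkcond /=.
rewrite (sum_planted_prod (fun _ b => if b then p else 1 - p)).
by rewrite big1 // => ij _; rewrite addrC subrK.
Qed.

Lemma er_mgf (R : realType) (p : R) k m (c : 'I_(k + m) * 'I_(k + m) -> R) :
  0 <= p <= 1 ->
  \sum_(G : sgraph (k + m)) er_mass p (clique k) G *
     expR (\sum_(ij | @free_pair k m ij) c ij * ((G ij.1 ij.2)%:R - p)) <=
  expR (2 * \sum_(ij | @free_pair k m ij) c ij ^+ 2).
Proof.
move=> /andP[p0 p1].
rewrite (eq_bigr (fun G => if planted (clique k) G then
   \prod_(ij | @free_pair k m ij) ((if G ij.1 ij.2 then p else 1 - p) *
       expR (c ij * ((G ij.1 ij.2)%:R - p))) else 0)); last first.
  move=> G _; rewrite /er_mass; case: ifP => _; last by rewrite mul0r.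
  by rewrite expR_sum big_split.
rewrite -big_mkcond /=.
rewrite (sum_planted_prod (fun ij b => (if b then p else 1 - p) * expR (c ij * (b%:R - p)))).
rewrite mulr_sumr expR_sum; apply: ler_prod => ij _ /=.
rewrite addr_ge0 ?mulr_ge0 ?expR_ge0 ?subr_ge0 //=.
have sq (x : R) : x ^+ 2 <= 1 -> expR (2 * (c ij * x) ^+ 2) <= expR (2 * c ij ^+ 2).
  move=> x1; rewrite ler_expR ler_pM2l // exprMn ler_piMr ?sqr_ge0 //.
have e1 := le_trans (expR_le_lin_sqr (c ij * (1 - p))) (lerD (lexx _) (sq (1 - p) _)).
have e0 := le_trans (expR_le_lin_sqr (c ij * (0 - p))) (lerD (lexx _) (sq (0 - p) _)).
have {}e1 := ler_wpM2l p0 (e1 ltac:(nra)).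
have q0 : 0 <= 1 - p by lra.
have {}e0 := ler_wpM2l q0 (e0 ltac:(nra)).
apply: le_trans (lerD e1 e0) _; lra.
Qed.

(** Markov's inequality for the exponential of l times the sum, with l to be
    optimized by the caller. *)
Lemma er_chernoff (R : realType) (p : R) k m (c : 'I_(k + m) * 'I_(k + m) -> R) (l t : R) :
  0 <= p <= 1 -> 0 <= l ->
  \sum_(G : sgraph (k + m) | t <=
     \sum_(ij | @free_pair k m ij) c ij * ((G ij.1 ij.2)%:R - p)) er_mass p (clique k) G <=
  expR (2 * l ^+ 2 * \sum_(ij | @free_pair k m ij) c ij ^+ 2 - l * t).
Proof.
move=> p01 l0; rewrite expRD.
have := er_mgf (fun ij => l * c ij) p01.
rewrite (eq_bigr (fun ij => l ^+ 2 * c ij ^+ 2)) => [|ij _]; last by rewrite exprMn.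
rewrite -mulr_sumr mulrA => mgf.
apply: le_trans (ler_wpM2r (expR_ge0 _) mgf).
rewrite mulr_suml big_mkcond; apply: ler_sum => G _.
have mG := er_mass_ge0 (clique k) G p01.
case: ifP => tS; last by rewrite !mulr_ge0 ?expR_ge0.
rewrite -mulrA -expRD ler_peMr // -[leLHS]expR0 ler_expR.
rewrite (eq_bigr (fun ij => l * (c ij * ((G ij.1 ij.2)%:R - p)))) => [|ij _]; last by rewrite mulrA.
by rewrite -mulr_sumr -mulrBr mulr_ge0 // subr_ge0.
Qed.

(** Non-planted graphs have mass 0, so only planted ones need a bad event. *)
Lemma er_union_bound (R : realType) (p : R) k m (I : finType) (P : pred I)
    (bad : I -> pred (sgraph (k + m))) (E : set (sgraph (k + m))) :
    0 <= p <= 1 ->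
    (forall G, planted (clique k) G -> (forall i, P i -> ~~ bad i G) -> E G) ->
  1 - \sum_(i | P i) \sum_(G | bad i G) er_mass p (clique k) G <=
  er_prob p (clique k) E.
Proof.
move=> p01 goodE; have m0 G := er_mass_ge0 (m := m) (clique k) G p01.
rewrite -(er_mass_sum1 p k m) lerBlDr /er_prob.
rewrite [X in _ <= X + _]big_mkcond /=.
under [X in _ <= _ + X]eq_bigr do rewrite big_mkcond.
rewrite exchange_big -big_split /=; apply: ler_sum => G _.
have S0 : 0 <= \sum_(i | P i) if bad i G then er_mass p (clique k) G else 0.
  by apply: sumr_ge0 => i _; case: ifP.
case: ifP => [_|/negP GE]; first by rewrite lerDl.
rewrite add0r; have [plG|] := boolP (planted (clique k) G); last first.
  by rewrite /er_mass => /negbTE ->; rewrite big1 // => i _; case: ifP.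
have [/existsP[i /andP[Pi Bi]]|/existsPn nb] := boolP [exists i, P i && bad i G].
  by rewrite (bigD1 i) //= Bi lerDl sumr_ge0 // => j _; case: ifP.
case: GE; rewrite inE; apply: goodE => // i Pi.
by have := nb i; rewrite Pi.
Qed.

(** * Tails of bilinear forms in the centred adjacency matrix *)

(** Every ordered pair of distinct nodes not both planted is a free pair in
    exactly one of its two orders. *)
Lemma sum_free_swap (R : realType) k m (H : 'I_(k + m) * 'I_(k + m) -> R) :
  \sum_(ij | @free_pair k m ij) (H ij + H (ij.2, ij.1)) =
  \sum_(ij : 'I_(k + m) * 'I_(k + m) | (ij.1 != ij.2) && ~~ ((ij.1 < k) && (ij.2 < k))%N) H ij.
Proof.
have swapK : involutive (fun ij : 'I_(k + m) * 'I_(k + m) => (ij.2, ij.1)) by case.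
rewrite big_split /= [X in _ + X](reindex_inj (inv_inj swapK)) /=.
rewrite [RHS](bigID (@free_pair k m)) /=; congr (_ + _).
  apply: eq_bigl => -[i j]; rewrite /free_pair /= -(inj_eq val_inj) neq_ltn /=.
  by case: (ltngtP i j) => //= ij; rewrite ?andbF //; have := ltn_ord i; lia.
apply: eq_big => [[i j]|[i j] //]; rewrite /free_pair /= -(inj_eq val_inj) neq_ltn /=.
by case: (ltngtP i j) => //= ij; lia.
Qed.

Lemma noise_form (R : realType) (p : R) k m (G : sgraph (k + m)) (z w : 'I_(k + m) -> R) :
  \sum_i \sum_j z i * noise p G i j * w j =
  \sum_(ij | @free_pair k m ij)
    (z ij.1 * w ij.2 + z ij.2 * w ij.1) * ((G ij.1 ij.2)%:R - p).
Proof.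
rewrite pair_big /=.
transitivity (\sum_(ij | @free_pair k m ij)
   (z ij.1 * ((G ij.1 ij.2)%:R - p) * w ij.2 + z ij.2 * ((G ij.2 ij.1)%:R - p) * w ij.1)).
  rewrite (sum_free_swap (fun ij => z ij.1 * ((G ij.1 ij.2)%:R - p) * w ij.2)).
  rewrite [RHS]big_mkcond; apply: eq_bigr => -[i j] _ /=; rewrite mxE.
  by case: ifP => //; rewrite mulr0 mul0r.
by apply: eq_bigr => -[i j] _ /=; rewrite (edge_sym G j i); ring.
Qed.

(** The coefficient of the free pair (i, j) is z_i w_j + z_j w_i, whose square is
    at most 2 (z_i^2 w_j^2 + z_j^2 w_i^2); these sum to at most 2 |z|^2 |w|^2. *)
Lemma noise_tail (R : realType) (p : R) k m (z w : 'I_(k + m) -> R) (l t : R) :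
  0 <= p <= 1 -> 0 <= l ->
  \sum_(G : sgraph (k + m) | t <= \sum_i \sum_j z i * noise p G i j * w j)
     er_mass p (clique k) G <=
  expR (4 * l ^+ 2 * ((\sum_i z i ^+ 2) * (\sum_i w i ^+ 2)) - l * t).
Proof.
move=> p01 l0; under eq_bigl do rewrite noise_form.
apply: le_trans (er_chernoff _ _ p01 l0) _; rewrite ler_expR lerD2r.
have -> : 4 * l ^+ 2 = 2 * l ^+ 2 * 2 by ring.
rewrite -[X in _ <= X]mulrA ler_wpM2l ?mulr_ge0 ?sqr_ge0 //.
pose H (ij : 'I_(k + m) * 'I_(k + m)) := 2 * (z ij.1 ^+ 2 * w ij.2 ^+ 2).
apply: (@le_trans _ _ (\sum_(ij | @free_pair k m ij) (H ij + H (ij.2, ij.1)))).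
  apply: ler_sum => -[i j] _; rewrite /H /= -subr_ge0.
  set e := (X in 0 <= X); have -> : e = (z i * w j - z j * w i) ^+ 2 by rewrite /e; ring.
  exact: sqr_ge0.
rewrite sum_free_swap mulr_suml mulr_sumr.
under [leRHS]eq_bigr do rewrite !mulr_sumr.
rewrite pair_big /= big_mkcond; apply: ler_sum => ij _.
by case: ifP => _; rewrite /H //; do 2?apply: mulr_ge0 => //; exact: sqr_ge0.
Qed.

(** * Discretization of the operator norm *)

(** The integers from -N to N, encoded by ordinals so that vectors of them form a
    finite type. *)
Definition lattice_coord (R : realType) (N : nat) (b : 'I_(N.*2.+1)) : R :=
  b%:R - N%:R.

Lemma expR_sqr_le (R : realType) (N : nat) : expR (- N%:R ^+ 2) <= 2^-1 ^+ N :> R.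
Proof.
rewrite expRN exprVn lef_pV2 ?posrE ?expR_gt0 ?exprn_gt0 //.
apply: (@le_trans _ _ (expR (1 * N%:R))).
  rewrite expRM_natr lerXn2r ?nnegrE ?expR_ge0 //.
  by have := @expR_ge1Dx R 1; rewrite -natr1.
by rewrite mul1r ler_expR -natrX ler_nat; case: N => // N; rewrite expnS leq_pmulr.
Qed.

(** The strengthened bound 3 - 2 / 2^N telescopes: passing to N + 1 adds the two
    end points, each at most 2^-(N + 1). *)
Lemma gauss_sum_le3 (R : realType) (N : nat) :
  \sum_(b < N.*2.+1) expR (- lattice_coord R b ^+ 2) <= 3.
Proof.
suff H : \sum_(b < N.*2.+1) expR (- lattice_coord R b ^+ 2) <= 3 - 2 * 2^-1 ^+ N.
  apply: le_trans H _; rewrite gerBl mulr_ge0 // exprn_ge0 // invr_ge0 //.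
elim: N => [|N IH].
  rewrite big_ord_recl big_ord0 /lattice_coord subrr expr0n /= oppr0 expR0; lra.
rewrite (big_ord_recl N.*2.+2) big_ord_recr /=.
have -> : \sum_(i < N.*2.+1) expR (- lattice_coord R (N := N.+1)
     (lift ord0 (widen_ord (leqnSn N.*2.+1) i)) ^+ 2) =
   \sum_(i < N.*2.+1) expR (- lattice_coord R i ^+ 2).
  apply: eq_bigr => i _; congr (expR (- _ ^+ 2)).
  by rewrite /lattice_coord /= /bump /= add1n -!natr1; ring.
have e1 : lattice_coord R (N := N.+1) ord0 ^+ 2 = N.+1%:R ^+ 2.
  by rewrite /lattice_coord /= sub0r sqrrN.
have e2 : lattice_coord R (N := N.+1) (lift ord0 ord_max) ^+ 2 = N.+1%:R ^+ 2.
  rewrite /lattice_coord (_ : nat_of_ord (lift ord0 ord_max) = (N + N).+2); last by rewrite addnn.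
  by rewrite -!natr1 natrD; congr (_ ^+ 2); ring.
rewrite e1 e2; have := expR_sqr_le R N.+1; rewrite [2^-1 ^+ _]exprS; lra.
Qed.

(** Coordinates up to n + 1 suffice, as rounding moves a coordinate of absolute
    value at most n by at most 1. *)
Definition lattice_short (R : realType) n (f : {ffun 'I_n -> 'I_(n.+1.*2.+1)}) : bool :=
  \sum_i lattice_coord R (f i) ^+ 2 <= 4 * n%:R.

(** Each short vector has weight exp (4 n - |z|^2) >= 1, and the total weight of
    all vectors is a product of one-dimensional sums. *)
Lemma card_lattice_short (R : realType) n :
  #|@lattice_short R n|%:R <= expR (6 * n%:R) :> R.
Proof.
rewrite -sum1_card natr_sum.
apply: (@le_trans _ _ (\sum_(f : {ffun 'I_n -> 'I_(n.+1.*2.+1)})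
    expR (4 * n%:R) * \prod_i expR (- lattice_coord R (f i) ^+ 2))).
  rewrite big_mkcond; apply: ler_sum => f _.
  rewrite -expR_sum -expRD; case: ifP => [sf|_]; last exact: expR_ge0.
  rewrite -[leLHS]expR0 ler_expR sumrN subr_ge0; exact: sf.
rewrite -mulr_sumr -(bigA_distr_bigA (fun i b => expR (- @lattice_coord R n.+1 b ^+ 2))) /=.
rewrite prodr_const card_ord.
have -> : 6 * n%:R = 4 * n%:R + 2 * n%:R :> R by ring.
rewrite expRD [expR (2 * _)]expRM_natr ler_pM2l ?expR_gt0 // lerXn2r ?nnegrE ?expR_ge0 //.
  by rewrite sumr_ge0 // => b _; apply: expR_ge0.
apply: le_trans (gauss_sum_le3 _ _) _.
by have := @expR_ge1Dx R 2; lra.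
Qed.

(** Rounding up or down according to the sign of c. *)
Lemma lattice_round1 (R : realType) n (c x : R) : x ^+ 2 <= n%:R ->
  exists b : 'I_(n.+1.*2.+1),
    c * x <= c * lattice_coord R b /\ lattice_coord R b ^+ 2 <= 2 * x ^+ 2 + 2.
Proof.
move=> xn.
have nn : n%:R <= n%:R ^+ 2 :> R.
  by rewrite -natrX ler_nat; case: n {xn} => // n; rewrite expnS leq_pmulr.
have n0 : 0 <= n%:R :> R by [].
have xl : - n%:R <= x by rewrite lerNl; nra.
have xu : x <= n%:R by nra.
have y0 : 0 <= x + n.+1%:R by rewrite -natr1; lra.
have /andP[tl tu] := truncn_itv y0.
set t := Num.truncn _ in tl tu.
have tN : (t < n.+1.*2)%N.
  rewrite -(ltr_nat R); apply: le_lt_trans tl _.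
  by rewrite -addnn natrD -natr1; lra.
rewrite -natr1 in tu.
have sq v : x - 1 <= v -> v <= x + 1 -> v ^+ 2 <= 2 * x ^+ 2 + 2.
  move=> l1 l2; have d1 : (v - x) ^+ 2 <= 1 by rewrite -[1]mulr1 expr2; nra.
  rewrite -subr_ge0; have -> : 2 * x ^+ 2 + 2 - v ^+ 2 =
    (v - 2 * x) ^+ 2 + 2 * (1 - (v - x) ^+ 2) by ring.
  by rewrite addr_ge0 ?sqr_ge0 // mulr_ge0 // subr_ge0.
have [c0|c0] := leP 0 c.
  have tN' : (t.+1 < n.+1.*2.+1)%N by [].
  exists (Ordinal tN'); rewrite /lattice_coord /= -[t.+1%:R]natr1; split;
    last by apply: sq; rewrite -?natr1; lra.
  by rewrite ler_wpM2l //; lra.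
have tN' : (t < n.+1.*2.+1)%N by rewrite ltnS ltnW.
exists (Ordinal tN'); rewrite /lattice_coord /=; split; last by apply: sq; rewrite -?natr1; lra.
by rewrite ler_nM2l //; lra.
Qed.

Lemma lattice_round (R : realType) n (c x : 'I_n -> R) : \sum_i x i ^+ 2 <= n%:R ->
  exists2 f, lattice_short R f &
    \sum_i c i * x i <= \sum_i c i * lattice_coord R (f i).
Proof.
move=> xn.
have x1 i : x i ^+ 2 <= n%:R.
  apply: le_trans xn; rewrite (bigD1 i) //= lerDl sumr_ge0 // => j _; exact: sqr_ge0.
have /fin_all_exists[b bP] := fun i => lattice_round1 (c i) (x1 i).
exists (finfun b); last by apply: ler_sum => i _; rewrite ffunE; have [] := bP i.
apply: (@le_trans _ _ (\sum_i (2 * x i ^+ 2 + 2))).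
  by apply: ler_sum => i _; rewrite ffunE; have [] := bP i.
rewrite big_split /= -mulr_sumr sumr_const card_ord -[2 *+ n]mulr_natr; lra.
Qed.

(** By homogeneity both vectors may be scaled to length sqrt n; then the left one
    is rounded with the right one fixed, and the right one with the rounded left
    one fixed.  Rounding never decreases the form, so no approximation error
    has to be absorbed, unlike with an epsilon-net. *)
Lemma bilin_le_lattice (R : realType) n (W : 'M[R]_n) (r : R) : 0 <= r ->
    (forall f g, lattice_short R f -> lattice_short R g ->
       \sum_i \sum_j lattice_coord R (f i) * W i j * lattice_coord R (g j) <= r * n%:R) ->
  forall z w : 'I_n -> R,
    2 * (\sum_i \sum_j z i * W i j * w j) <= r * (\sum_i z i ^+ 2 + \sum_i w i ^+ 2).
Proof.
move=> r0 Wfg.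
have unit (z w : 'I_n -> R) : \sum_i z i ^+ 2 <= n%:R -> \sum_i w i ^+ 2 <= n%:R ->
    \sum_i \sum_j z i * W i j * w j <= r * n%:R.
  move=> zn wn.
  have [f sf fP] := lattice_round (fun i => \sum_j W i j * w j) zn.
  have [g sg gP] := lattice_round (fun j => \sum_i lattice_coord R (f i) * W i j) wn.
  apply: le_trans (Wfg f g sf sg).
  apply: (@le_trans _ _ (\sum_j (\sum_i lattice_coord R (f i) * W i j) * w j)).
    have -> : \sum_j (\sum_i lattice_coord R (f i) * W i j) * w j =
       \sum_i (\sum_j W i j * w j) * lattice_coord R (f i).
      under eq_bigr do rewrite mulr_suml.
      rewrite exchange_big /=; apply: eq_bigr => i _; rewrite mulr_suml.
      by apply: eq_bigr => j _; ring.
    apply: le_trans fP; rewrite le_eqVlt; apply/orP; left; apply/eqP.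
    by apply: eq_bigr => i _; rewrite mulr_suml; apply: eq_bigr => j _; ring.
  apply: le_trans gP _; rewrite le_eqVlt; apply/orP; left; apply/eqP.
  rewrite exchange_big; apply: eq_bigr => j _ /=; rewrite mulr_suml.
  by apply: eq_bigr.
move=> z w.
set A := \sum_i z i ^+ 2; set B := \sum_i w i ^+ 2.
have A0 : 0 <= A by apply: sumr_ge0 => i _; apply: sqr_ge0.
have B0 : 0 <= B by apply: sumr_ge0 => i _; apply: sqr_ge0.
have zero (v : 'I_n -> R) : \sum_i v i ^+ 2 = 0 -> forall i, v i = 0.
  move=> v0 i; apply/eqP; rewrite -sqrf_eq0; move/eqP: v0.
  by rewrite psumr_eq0 => [/allP/(_ i (mem_index_enum i))//|j _]; apply: sqr_ge0.
have RHS0 : 0 <= r * (A + B) by rewrite mulr_ge0 ?addr_ge0.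
have [Az|An] := eqVneq A 0.
  rewrite big1 ?mulr0 // => i _; rewrite big1 // => j _.
  by rewrite (zero _ Az) !mul0r.
have [Bz|Bn] := eqVneq B 0.
  rewrite big1 ?mulr0 // => i _; rewrite big1 // => j _.
  by rewrite (zero _ Bz) mulr0.
have Ap : 0 < A by rewrite lt_def An.
have Bp : 0 < B by rewrite lt_def Bn.
have n0 : 0 < n%:R :> R.
  rewrite ltr0n lt0n; apply: contraNneq An => n0; rewrite /A big1 // => i _.
  by have := ltn_ord i; rewrite [X in (_ < X)%N]n0.
pose a := Num.sqrt A; pose b := Num.sqrt B.
have a0 : 0 < a by rewrite sqrtr_gt0.
have b0 : 0 < b by rewrite sqrtr_gt0.
have aa : a ^+ 2 = A by rewrite sqr_sqrtr.
have bb : b ^+ 2 = B by rewrite sqr_sqrtr.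
pose q := Num.sqrt (n%:R : R).
have qq : q ^+ 2 = n%:R by rewrite sqr_sqrtr // ltW.
have scal (v : 'I_n -> R) d : 0 < d -> d ^+ 2 = \sum_i v i ^+ 2 ->
   \sum_i (q / d * v i) ^+ 2 <= n%:R.
  move=> d0 dv; under eq_bigr do rewrite exprMn.
  rewrite -mulr_sumr -dv -exprMn mulfVK ?gt_eqF // qq //.
have := unit _ _ (scal z a a0 aa) (scal w b b0 bb).
have -> : \sum_i \sum_j q / a * z i * W i j * (q / b * w j) =
   n%:R / (a * b) * (\sum_i \sum_j z i * W i j * w j).
  rewrite mulr_sumr; apply: eq_bigr => i _; rewrite mulr_sumr; apply: eq_bigr => j _.
  rewrite -qq; field; rewrite !gt_eqF //.
set S := \sum_i _ => HS.
have {}HS : S <= r * (a * b).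
  have ab : 0 < a * b by rewrite mulr_gt0.
  rewrite -(ler_pM2l (divr_gt0 n0 ab)); apply: le_trans HS _.
  by rewrite le_eqVlt; apply/orP; left; apply/eqP; field; rewrite !gt_eqF.
have : r * (2 * (a * b)) <= r * (A + B).
  apply: ler_wpM2l => //; rewrite -aa -bb -subr_ge0.
  have -> : a ^+ 2 + b ^+ 2 - 2 * (a * b) = (a - b) ^+ 2 by ring.
  exact: sqr_ge0.
lra.
Qed.

(** * Probability of success *)

(** With r = (1 - p) k / 16, the first term is the bound exp (12 n) on the
    number of pairs of short vectors times the tail bound exp (- r^2 / 256) at
    level r n, and the second one covers the degrees into the clique of the n
    nodes. *)
Lemma success_prob (R : realType) (p : R) (k m : nat) :
    0 <= p < 1 -> (8 <= k)%N ->
  1 - (expR (12 * (k + m)%:R - (1 - p) ^+ 2 / 256 ^+ 2 * k%:R ^+ 2) +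
       (k + m)%:R * expR (- ((1 - p) ^+ 2 / 64 * k%:R))) <=
  er_prob p (clique k) [set G : sgraph (k + m) | sh_succeeds (clique k) (-1 : R) G].
Proof.
move=> /andP[p0 p1] k8.
have p01 : 0 <= p <= 1 by rewrite p0 ltW.
have q0 : 0 < 1 - p by rewrite subr_gt0.
set n := (k + m)%N.
have n0 : 0 < n%:R :> R by rewrite ltr0n /n addn_gt0 (leq_trans _ k8).
pose L := {ffun 'I_n -> 'I_(n.+1.*2.+1)}.
pose r := (1 - p) / 16 * k%:R.
have r0 : 0 <= r by rewrite mulr_ge0 // divr_ge0 // ltW.
pose v (i : 'I_n) : R := (i < k)%N%:R.
pose d (j i : 'I_n) : R := (i == j)%:R.
(* The form with z = v and w the indicator of j is the centred degree of j. *)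
pose bad (x : (L * L) + 'I_n) : pred (sgraph n) := fun G =>
  match x with
  | inl fg => r * n%:R <= \sum_i \sum_j
      lattice_coord R (fg.1 i) * noise p G i j * lattice_coord R (fg.2 j)
  | inr j => (1 - p) / 2 * k%:R <= \sum_i \sum_i' v i * noise p G i i' * d j i'
  end.
pose P (x : (L * L) + 'I_n) :=
  if x is inl fg then lattice_short R fg.1 && lattice_short R fg.2 else true.
apply: le_trans (@er_union_bound R p k m _ P bad _ p01 _); last first.
  move=> G plG good; apply: (planted_succeeds p1 k8 plG) => [j _|].
    have := good (inr j) isT; rewrite -ltNge /= => /ltW; apply: le_trans.
    rewrite le_eqVlt; apply/orP; left; apply/eqP.
    rewrite big_mkcond; apply: eq_bigr => i _.
    rewrite (bigD1 j) //= big1 ?addr0 /d ?eqxx ?mulr1 => [|i' /negbTE ->]; last by rewrite mulr0.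
    by rewrite /v; case: ifP => _; rewrite ?mul1r ?mul0r.
  apply: bilin_le_lattice => // f g sf sg.
  by have := good (inl (f, g)); rewrite -ltNge /= sf sg => /(_ isT)/ltW.
rewrite lerD2l lerN2 big_sumType /=; apply: lerD; last first.
  apply: (@le_trans _ _ (\sum_(j < n) expR (- ((1 - p) ^+ 2 / 64 * k%:R)))); last first.
    by rewrite sumr_const card_ord -[_ *+ n]mulr_natl.
  apply: ler_sum => j _.
  (* This parameter minimizes the exponent of the tail bound. *)
  have l0 : 0 <= (1 - p) / 16 by rewrite divr_ge0 // ltW.
  apply: le_trans (noise_tail _ _ _ p01 l0) _; rewrite ler_expR.
  have -> : \sum_i v i ^+ 2 = k%:R.
    rewrite -(sum_planted_nodes R k m); apply: eq_bigr => i _.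
    by rewrite /v; case: (i < k)%N; rewrite ?expr1n ?expr0n.
  have -> : \sum_i d j i ^+ 2 = 1.
    rewrite (bigD1 j) //= big1 ?addr0 /d ?eqxx ?expr1n // => i /negbTE ->.
    by rewrite expr0n.
  lra.
apply: (@le_trans _ _ (\sum_(fg : L * L | lattice_short R fg.1 && lattice_short R fg.2)
    expR (- ((1 - p) ^+ 2 / 256 ^+ 2 * k%:R ^+ 2)))).
  apply: ler_sum => -[f g] /= /andP[sf sg].
  (* This parameter minimizes the exponent, both squared lengths being 4 n. *)
  have l0 : 0 <= r / (128 * n%:R) by rewrite divr_ge0 // mulr_ge0 // ltW.
  apply: le_trans (noise_tail _ _ _ p01 l0) _; rewrite ler_expR.
  have fg : (\sum_i lattice_coord R (f i) ^+ 2) * (\sum_i lattice_coord R (g i) ^+ 2)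
      <= (4 * n%:R) * (4 * n%:R).
    by apply: ler_pM => //; apply: sumr_ge0 => i _; apply: sqr_ge0.
  have l2 : 0 <= 4 * (r / (128 * n%:R)) ^+ 2 by rewrite mulr_ge0 // sqr_ge0.
  have := ler_wpM2l l2 fg.
  have -> : 4 * (r / (128 * n%:R)) ^+ 2 * (4 * n%:R * (4 * n%:R)) = r ^+ 2 / 256.
    by field; rewrite gt_eqF.
  have -> : r / (128 * n%:R) * (r * n%:R) = r ^+ 2 / 128.
    by field; rewrite gt_eqF.
  have -> : (1 - p) ^+ 2 / 256 ^+ 2 * k%:R ^+ 2 = r ^+ 2 / 256 by rewrite /r; field.
  lra.
rewrite sumr_const -[_ *+ _]mulr_natl expRD ler_pM2r ?expR_gt0 //.
have -> : #|[pred fg : L * L | lattice_short R fg.1 && lattice_short R fg.2]| =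
   (#|@lattice_short R n| * #|@lattice_short R n|)%N.
  by rewrite -cardX; apply: eq_card => -[f g].
have -> : 12 * n%:R = 6 * n%:R + 6 * n%:R :> R by ring.
by rewrite expRD natrM ler_pM // card_lattice_short.
Qed.

Theorem corollary21 (R : realType) (p : R) (hp : 0 <= p < 1) :
  exists2 beta : R, 0 < beta &
    forall m : nat -> nat, (forall k : nat, (0 < k)%N -> (0 < m k)%N) ->
      exists C c : R, [/\ 0 < C, 0 < c
        & forall k : nat, (0 < k)%N -> (k + m k)%:R <= beta * k%:R ^+ 2 ->
            1 - C * expR (- (c * k%:R)) <=
            er_prob p (clique k)
              [set G : sgraph (k + m k) | sh_succeeds (clique k) (-1 : R) G]].
Proof.
have /andP[p0 p1] := hp.
set q := (1 - p) ^+ 2.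
have q0 : 0 < q by rewrite exprn_gt0 // subr_gt0.
have q1 : q <= 1 by rewrite /q; nra.
have D0 : 0 < 256 ^+ 2 :> R by rewrite exprn_gt0.
(* With this beta, 12 n is at most half of the exponent q / 256^2 * k^2. *)
exists (q / (24 * 256 ^+ 2)); first by rewrite divr_gt0 // mulr_gt0.
move=> m m0; exists (1 + 16 / (q / 64) ^+ 2), (q / (2 * 256 ^+ 2)).
have C0 : 0 < 16 / (q / 64) ^+ 2 by rewrite divr_gt0 // exprn_gt0 // divr_gt0.
split; [by rewrite addr_gt0|by rewrite divr_gt0 // mulr_gt0|].
move=> k k0 nk; set n := (k + m k)%N in nk *.
have K0 : 1 <= k%:R :> R by rewrite ler1n.
have kn : k%:R <= n%:R :> R by rewrite ler_nat leq_addr.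
(* k < n <= beta k^2 forces k >= 1 / beta. *)
have k8 : (8 <= k)%N.
  rewrite -(ler_nat R).
  have h : k%:R * 1 <= k%:R * (q / (24 * 256 ^+ 2) * k%:R).
    by rewrite mulr1; apply: le_trans kn (le_trans nk _); rewrite expr2; lra.
  rewrite ler_pM2l in h; last by lra.
  nra.
apply: le_trans (success_prob (m k) hp k8); rewrite -/q -/n.
rewrite lerD2l lerN2 [leRHS]mulrDl mul1r; apply: lerD.
  rewrite ler_expR.
  have : k%:R <= k%:R ^+ 2 :> R by rewrite expr2 ler_peMl //; lra.
  move=> kk; have := ler_wpM2l (ltW q0) kk; lra.
set c2 := q / 64.
have c20 : 0 < c2 by rewrite divr_gt0.
have e4 : c2 * k%:R / 4 <= expR (c2 * k%:R / 4).
  by apply: le_trans (expR_ge1Dx _); rewrite lerDr.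
(* Half of the exponent of the degree term pays for the factor n. *)
have nb : n%:R <= 16 / c2 ^+ 2 * expR (c2 * k%:R / 2).
  have -> : expR (c2 * k%:R / 2) = expR (c2 * k%:R / 4) ^+ 2.
    by rewrite -expRM_natr; congr expR; lra.
  have : (c2 * k%:R / 4) ^+ 2 <= expR (c2 * k%:R / 4) ^+ 2.
    have e40 : 0 <= c2 * k%:R / 4 by rewrite divr_ge0 // mulr_ge0 // ltW.
    by rewrite lerXn2r // nnegrE expR_ge0.
  move=> /(ler_wpM2l (ltW C0)); apply: le_trans.
  have -> : 16 / c2 ^+ 2 * (c2 * k%:R / 4) ^+ 2 = k%:R ^+ 2 by field; rewrite gt_eqF.
  apply: le_trans nk _; rewrite ler_piMl ?sqr_ge0 //; lra.
apply: le_trans (ler_wpM2r (expR_ge0 _) nb) _.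
rewrite -[leLHS]mulrA ler_pM2l // -expRD ler_expR.
have := ler_wpM2l (ltW q0) K0; rewrite /c2; lra.
Qed.
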